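(* Let $p\in\mathbb{R}$, $a>0$, $b>0$. A positive random variable $X$ follows the $\mathrm{GIG}(p,a,b)$ distribution if and only if, for any differentiable function $h$ on $(0,\infty)$ satisfying $$\lim_{x\to\infty}f_{p,a,b}(x)h(x)=\lim_{x\to 0}f_{p,a,b}(x)h(x)=0,$$ we have $$\mathbb{E}\left[h'(X)+\left(\frac{p-1}{X}+\frac{b}{2X^2}-\frac{a}{2}\right)h(X)\right]=0.$$ (The functional $h\mapsto\mathcal{T}_{f_{p,a,b}}(h)(x):=h'(x)+\left(\frac{p-1}{x}+\frac{b}{2x^2}-\frac{a}{2}\right)h(x)$ is called the GIG Stein operator.)
   Context: For $p\in\mathbb{R}$, $a>0$, $b>0$, the Generalized Inverse Gaussian distribution $\mathrm{GIG}(p,a,b)$ is the distribution on $(0,\infty)$ with density $$f_{p,a,b}(x)=\frac{(a/b)^{p/2}}{2K_p(\sqrt{ab})}\,x^{p-1}e^{-(ax+b/x)/2},\quad x>0,$$ where $K_p$ is the modified Bessel function of the third kind, $K_p(z)=2^{-p-1}z^{p}\int_0^\infty x^{-p-1}e^{-x-\frac{z^2}{4x}}\,dx$ for $z>0$.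
   Formalization: The identity is required only for those differentiable h for which h'(X)+((p-1)/X+b/(2X²)-a/2)h(X) is integrable; for some admissible h (e.g. f·h = x² sin(1/x⁴) near 0) the expectation does not exist. *)

(* Defs.v *)
From HB Require Import structures.
From mathcomp Require Import all_boot all_order all_algebra.
From mathcomp Require Import all_classical all_reals all_analysis.

Set Implicit Arguments.
Unset Strict Implicit.
Unset Printing Implicit Defensive.

Import Order.TTheory GRing.Theory Num.Theory.
Import numFieldNormedType.Exports.

Local Open Scope classical_set_scope.
Local Open Scope ring_scope.

(* Modified Bessel function of the third kind; only meaningful for [0 < z]. *)
Definition besselK {R : realType} (p z : R) : R :=
  2 `^ (- p - 1) * z `^ p *
  \int[lebesgue_measure]_(x in `]0, +oo[)
    (x `^ (- p - 1) * expR (- x - z ^+ 2 / (4 * x))).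

(* Density of GIG(p, a, b), extended by 0 outside of ]0, +oo[. *)
Definition gig_pdf {R : realType} (p a b : R) : R -> R :=
  (fun x => (a / b) `^ (p / 2) / (2 * besselK p (Num.sqrt (a * b))) *
            x `^ (p - 1) * expR (- (a * x + b / x) / 2)) \_ `]0, +oo[.

Definition gig_prob {R : realType} (p a b : R) (A : set R) : \bar R :=
  (\int[lebesgue_measure]_(x in A) (gig_pdf p a b x)%:E)%E.

Definition follows_gig {d : measure_display} {T : measurableType d}
    {R : realType} (P : probability T R) (X : {RV P >-> R}) (p a b : R) : Prop :=
  forall A : set R, measurable A -> distribution P X A = gig_prob p a b A.

Definition gig_stein {R : realType} (p a b : R) (h : R -> R) (x : R) : R :=
  derive1 h x + ((p - 1) / x + b / (2 * x ^+ 2) - a / 2) * h x.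

(* Functions on ]0, +oo[ are total functions whose values outside of ]0, +oo[
   are unconstrained; accordingly the limit at 0 is a limit from the right. *)
Definition gig_test_function {R : realType} (p a b : R) (h : R -> R) : Prop :=
  [/\ forall x, 0 < x -> derivable h x 1,
      gig_pdf p a b x * h x @[x --> +oo] --> 0 &
      gig_pdf p a b x * h x @[x --> 0^'+] --> 0].

(* Main.v *)
Require Import Defs.
From HB Require Import structures.
From mathcomp Require Import all_boot all_order all_algebra.
From mathcomp Require Import all_classical all_reals all_analysis.
From mathcomp Require Import measurable_realfun ring lra.

Set Implicit Arguments.
Unset Strict Implicit.
Unset Printing Implicit Defensive.

Import Order.TTheory GRing.Theory Num.Theory.
Import numFieldNormedType.Exports.

Local Open Scope classical_set_scope.
Local Open Scope ring_scope.

(** Write f for the density of GIG(p, a, b).  On ]0, +oo[ its logarithmic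
derivative is (p - 1) / x + b / (2 x^2) - a / 2, so the Stein operator is
h |-> (f h)' / f, and both directions come from integrating (f h)'.

Law implies identity.  Against the law, the Stein operator integrates to the
Lebesgue integral of (f h)' over ]0, +oo[, which should be the difference of
the two boundary limits of f h, namely 0.  The function h is differentiable
and nothing more, so (f h)' need not be continuous, nor locally bounded: what
is needed is the fundamental theorem of calculus for a function F that is
differentiable at every point and whose derivative is merely integrable
([derivable_integrable_FTC2]).  Its proof replaces Riemann sums by a local
estimate.  A measurable w >= 0 of small integral can be chosen so that, around
each t, the oscillation |F' x - F' t| is at most w x
([oscillation_majorant]).  Hence the increments of F minus the indefinite
integral of F' are locally dominated by those of a nondecreasing function of
small total increase, and a supremum argument makes this global
([increment_le_of_local]).  Exhausting ]0, +oo[ by compact intervals gives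
[derivable_integrable_FTC0y].

Identity implies law.  For a continuous g with values in [0, 1] and
m the integral of g f, the function h x = (1 / f x) \int_0^x (g - m) f is an
admissible test function, as f h tends to 0 at both ends, and it solves the
Stein equation: the operator sends it to g - m ([gig_stein_solution]).  This
image is bounded, hence integrable, so E[g(X)] = m.  Letting g increase to the
indicators of the rays ]-oo, t[ identifies the law
([density_eq_of_continuous]).

The limit of f h at +oo is 0 only because f has total mass 1, that is, because
the Bessel function gives the right normalising constant; the substitution
x = b / (2 y) in its integral representation shows this
([besselK_gig_mass]). *)

(** * A fundamental theorem of calculus for integrable derivatives *)

(** A comparison of increments around every point propagates to the whole
segment, because the points reached from u form a set closed under suprema
and open to the right. *)
Lemma increment_le_of_local (R : realType) (Phi Psi : R -> R) (u v : R) :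
  u <= v ->
  (forall t, u <= t <= v -> exists2 d, 0 < d & forall y z,
     u <= y <= t -> t <= z <= v -> t - y < d -> z - t < d ->
     `|Phi z - Phi y| <= Psi z - Psi y) ->
  `|Phi v - Phi u| <= Psi v - Psi u.
Proof.
move=> uv loc.
pose S := [set x | u <= x <= v /\ `|Phi x - Phi u| <= Psi x - Psi u].
have chain y z : `|Phi y - Phi u| <= Psi y - Psi u ->
    `|Phi z - Phi y| <= Psi z - Psi y -> `|Phi z - Phi u| <= Psi z - Psi u.
  move=> h1 h2; have := ler_distD (Phi y) (Phi z) (Phi u); lra.
have Su : S u by split; rewrite ?lexx ?uv// !subrr normr0.
have supS : has_sup S by split; [exists u|exists v => x [/andP[]]].
set s := sup S.
have us : u <= s by exact: sup_upper_bound.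
have sv : s <= v by apply: sup_le_ub; [exists u|move=> x [/andP[]]].
have [d d0 hd] := loc s (introT andP (conj us sv)).
have [y [/andP[uy yv] hy] ys] := sup_adherent d0 supS.
have ys' : y <= s by apply: sup_upper_bound => //; split => //; exact/andP.
have reach z : s <= z -> z <= v -> z - s < d -> S z.
  move=> sz zv zd; split; first by rewrite zv (le_trans us).
  by apply: chain hy _; apply: hd => //; rewrite ?uy ?sz// ltrBlDr addrC -ltrBlDr.
have [vd|dv] := ltP (v - s) d; first by have [] := reach v sv (lexx _) vd.
have /(sup_upper_bound supS) : S (s + d / 2).
  apply: reach; rewrite ?lerDl; lra.
by rewrite -/s; lra.
Qed.

(** Off a countable union of small sets, f is nearly constant near each point.
The level sets E k = {|f - q k| < r}, with q enumerating a grid of step r,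
cover the segment; each lies in an open U k such that |q k| + |f| has tiny
integral over U k \ E k.  Around a point t of E k, a point x of U k is either
in E k, where f x and f t differ by at most 2 r, or in U k \ E k, where the
crude bound r + |q k| + |f x| is affordable.  Summing the crude bounds over k
gives w.  This plays the role of a semicontinuous majorant in the
Vitali-Caratheodory theorem. *)
Lemma oscillation_majorant (R : realType) (f : R -> R) (u v e : R) :
  0 < e -> u <= v ->
  lebesgue_measure.-integrable `[u, v] (EFin \o f) ->
  exists w : R -> \bar R,
    [/\ measurable_fun `[u, v] w, forall x, (0 <= w x)%E,
        (\int[lebesgue_measure]_(x in `[u, v]) w x <= e%:E)%E &
        forall t, t \in `[u, v] -> \forall x \near t, x \in `[u, v] ->
          (`|f x - f t|%:E <= w x)%E].
Proof.
move=> e0 uv intf.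
have mf : measurable_fun `[u, v] f by have /integrableP[/measurable_EFinP] := intf.
have mI : measurable (`[u, v] : set R) by exact: measurable_itv.
(* the constant part 2 r of w then contributes at most e / 2 *)
pose r := e / (4 * (1 + (v - u))).
have r0 : 0 < r by rewrite /r divr_gt0// mulr_gt0// ltr_wpDr// subr_ge0.
have re : r * (4 * (1 + (v - u))) = e.
  by rewrite /r divfK// gt_eqF// mulr_gt0// ltr_wpDr// subr_ge0.
have muuv : lebesgue_measure (`[u, v]%classic : set R) = (v - u)%:E.
  rewrite lebesgue_measure_itv/= lte_fin; case: ltP => [_|vu]; first by rewrite EFinB.
  by rewrite (@le_anti _ _ u v) ?uv// subrr.
pose q (k : nat) : R := if unpickle k is Some z then (z : int)%:~R * r else 0.
have qP y : exists k, `|y - q k| < r.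
  exists (pickle (Num.floor (y / r))); rewrite /q pickleK.
  set z := Num.floor _.
  have zl : z%:~R * r <= y by rewrite -ler_pdivlMr// floor_le.
  have zg : y < (z + 1)%:~R * r by rewrite -ltr_pdivrMr// floorD1_gt.
  move: zg; rewrite intrD mulrDl mul1r => zg; rewrite ger0_norm; lra.
pose E k := `[u, v] `&` [set x | `|f x - q k| < r].
have mE k : measurable (E k).
  have : measurable_fun `[u, v] (fun x => `|f x - q k|).
    by apply: measurableT_comp => //; exact: measurable_funB.
  move=> /(_ mI _ (measurable_itv `]-oo, r[)).
  by congr (measurable (_ `&` _)).
pose g k (x : R) : R := `|q k| + `|f x|.
have g0 k x : 0 <= g k x by rewrite addr_ge0.
have intg k : lebesgue_measure.-integrable `[u, v] (EFin \o g k).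
  have -> : EFin \o g k = (EFin \o cst `|q k|) \+ (EFin \o (fun x => `|f x|)).
    by apply/funext.
  apply: integrableD => //; last exact: integrable_norm.
  apply: continuous_compact_integrable; first exact: segment_compact.
  by apply: continuous_subspaceT => x; exact: cst_continuous.
pose c k : R := e / 2 / (2 ^ k.+1)%:R.
have c0 k : 0 < c k by rewrite divr_gt0// divr_gt0.
have UP k : exists U : set R, [/\ open U, E k `<=` U &
    (\int[lebesgue_measure]_(x in (U `\` E k) `&` `[u, v]) (g k x)%:E <= (c k)%:E)%E].
  have intg' : lebesgue_measure.-integrable setT (EFin \o (g k \_ `[u, v])).
    by rewrite -restrict_EFin; apply/integrable_restrict => //=; rewrite setTI.
  have [d [d0 hd]] := integral_normr_continuous intg' (c0 k).
  have finE : (lebesgue_measure (E k) < +oo)%E.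
    apply: (@le_lt_trans _ _ (lebesgue_measure (`[u, v] : set R))).
      by apply: le_measure; rewrite ?inE; [exact: mE|exact: mI|exact: subIsetl].
    by rewrite muuv ltry.
  have [U [oU EU mU]] := lebesgue_regularity_outer (mE k) finE d0.
  exists U; split => //.
  have mUE : measurable (U `\` E k) by apply: measurableD => //; exact: open_measurable.
  have := hd _ mUE mU.
  rewrite /Rintegral -lte_fin.
  have -> : (\int[lebesgue_measure]_(x in U `\` E k) (`|(g k \_ `[u, v]) x|)%:E =
     \int[lebesgue_measure]_(x in (U `\` E k) `&` `[u, v]) (g k x)%:E)%E.
    rewrite [RHS]integral_mkcondr; apply: eq_integral => x _.
    by rewrite /= !patchE; case: ifPn; rewrite ?normr0// ger0_norm.
  rewrite fineK; first exact: ltW.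
  apply: integrable_fin_num; first exact: measurableI.
  apply: integrableS (intg k) => //; exact: measurableI.
pose U k := projT1 (cid (UP k)).
have UE k : [/\ open (U k), E k `<=` U k &
    (\int[lebesgue_measure]_(x in (U k `\` E k) `&` `[u, v]) (g k x)%:E <= (c k)%:E)%E].
  by rewrite /U; case: cid.
pose A k := U k `\` E k.
have mA k : measurable (A k).
  by apply: measurableD => //; apply: open_measurable; have [] := UE k.
pose a k x : \bar R := ((g k \_ (A k)) x)%:E.
have a0 k x : (0 <= a k x)%E.
  by rewrite /a lee_fin patchE; case: ifP.
have ma k : measurable_fun `[u, v] (a k).
  apply/measurable_EFinP; apply/measurable_restrict => //.
  by apply: measurable_funS (_ : measurable_fun `[u, v] _) => //;
    have /integrableP[/measurable_EFinP] := intg k.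
pose w x := ((2 * r)%:E + \sum_(0 <= k <oo) a k x)%E.
have s0 x : (0 <= \sum_(0 <= k <oo) a k x)%E by apply: nneseries_ge0.
have ms : measurable_fun `[u, v] (fun x => \sum_(0 <= k <oo) a k x)%E.
  by apply: ge0_emeasurable_sum.
exists w; split.
- exact: emeasurable_funD.
- by move=> x; rewrite /w adde_ge0// lee_fin mulr_ge0// ltW.
- rewrite /w ge0_integralD//=.
  + rewrite integral_cst// integral_nneseries//.
    have -> : (e%:E = (e / 2)%:E + (e / 2)%:E)%E by rewrite -EFinD -splitr.
    apply: leeD.
      rewrite [X in (_ * X)%E](_ : _ = (v - u)%:E); last exact: muuv.
      rewrite -EFinM lee_fin; lra.
    apply: le_trans (epsilon_trick0 xpredT _); last by rewrite divr_ge0// ltW.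
    apply: lee_nneseries => k _; first by move=> ?; exact: integral_ge0.
    have [_ _] := UE k; apply: le_trans.
    rewrite [X in (_ <= X)%E]integral_mkcondl le_eqVlt; apply/orP; left; apply/eqP.
    apply: eq_integral => x _; rewrite /a !patchE; case: ifP => //.
  + by move=> x _; rewrite lee_fin mulr_ge0// ltW.
- move=> t tuv; have [k hk] := qP (f t).
  have [oU EU _] := UE k.
  have Ut : U k t by apply: EU; split.
  have := open_nbhs_nbhs (conj oU Ut); apply: filterS => x Ux xuv.
  have [Ex|nEx] := pselect (E k x).
    case: Ex => _ /= hx.
    apply: (@le_trans _ _ (2 * r)%:E); last by rewrite /w leeDl.
    rewrite lee_fin; have := ler_distD (q k) (f x) (f t).
    rewrite (distrC (q k)); lra.
  apply: (@le_trans _ _ (r + g k x)%:E).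
    rewrite lee_fin /g; have := ler_normB (f x) (f t).
    have := ler_normD (f t - q k) (q k); rewrite subrK; lra.
  rewrite /w EFinD leeD// ?lee_fin; first lra.
  have -> : (g k x)%:E = a k x by rewrite /a patchE mem_set.
  rewrite (nneseries_split _ k.+1)//.
  rewrite big_nat_recr//= -addeA addeC -addeA leeDl// adde_ge0//.
    exact: nneseries_ge0.
  exact: sume_ge0.
Qed.

Lemma derive1_linear_approx (R : realType) (F : R -> R) (t l e : R) :
  is_derive t 1 F l -> 0 < e ->
  \forall x \near t, `|F x - F t - l * (x - t)| <= e * `|x - t|.
Proof.
move=> /is_derive1_caratheodory[g [gE gt <-]] e0.
move/cvgrPdist_le : gt => /(_ _ e0); apply: filterS => x hx.
by rewrite gE -mulrBl normrM ler_wpM2r// distrC.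
Qed.

(** The defect Phi x = F x - \int_u^x f has increments locally dominated by
those of Psi x = \int_u^x w + e' x: the linear approximation of F at t costs
e' (z - y), and replacing f by f t on [y, z] costs the integral of w. *)
Lemma derivable_integrable_FTC2 (R : realType) (F f : R -> R) (u v : R) :
  u <= v ->
  (forall t, t \in `[u, v] -> is_derive t 1 F (f t)) ->
  lebesgue_measure.-integrable `[u, v] (EFin \o f) ->
  \int[lebesgue_measure]_(x in `[u, v]) f x = F v - F u.
Proof.
move=> uv dF intf.
suff H e : 0 < e -> `|F v - F u - \int[lebesgue_measure]_(x in `[u, v]) f x| <= e.
  apply/eqP; rewrite eq_sym -subr_eq0 -normr_le0.
  by apply/ler_addgt0Pl => e e0; rewrite addr0 H.
move=> e0.
pose e' := e / (2 * (1 + (v - u))).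
have e'0 : 0 < e' by rewrite divr_gt0// mulr_gt0// ltr_wpDr// subr_ge0.
have e'E : e' * (2 * (1 + (v - u))) = e.
  by rewrite /e' divfK// gt_eqF// mulr_gt0// ltr_wpDr// subr_ge0.
have [w [mw w0 iw ow]] := oscillation_majorant e'0 uv intf.
(* the excess of F over the indefinite integral of f, and a nondecreasing
   function of total increase at most e' + e' (v - u) *)
pose Phi x := F x - \int[lebesgue_measure]_(y in `[u, x]) f y.
pose Psi x := fine (\int[lebesgue_measure]_(y in `[u, x]) w y) + e' * x.
have sub y z : u <= y -> z <= v -> `[y, z] `<=` `[u, v].
  by move=> uy zv; apply: subset_itv; rewrite bnd_simp.
have sub' y z : u <= y -> z <= v -> `]y, z] `<=` `[u, v].
  by move=> uy zv; apply: subset_itv; rewrite bnd_simp.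
have Ifin y z : u <= y -> z <= v ->
    (\int[lebesgue_measure]_(x in `[y, z]) w x)%E \is a fin_num.
  move=> uy zv; rewrite ge0_fin_numE ?integral_ge0//.
  apply: le_lt_trans (ltry e'); apply: le_trans iw.
  by apply: ge0_subset_integral => //; exact: sub.
have Wadd y z : u <= y -> y <= z -> z <= v ->
    fine (\int[lebesgue_measure]_(x in `[u, z]) w x) -
    fine (\int[lebesgue_measure]_(x in `[u, y]) w x) =
    fine (\int[lebesgue_measure]_(x in `[y, z]) w x).
  move=> uy yz zv; have yv := le_trans yz zv.
  apply/eqP; rewrite subr_eq addrC -fineD ?Ifin//; apply/eqP; congr fine.
  rewrite (@itv_bndbnd_setU _ _ _ (BRight y))// ?bnd_simp//.
  rewrite ge0_integral_setU//=.
  - rewrite integral_itv_obnd_cbnd//; apply: measurable_funS mw => //.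
    exact: sub'.
  - rewrite -itv_bndbnd_setU ?bnd_simp//; apply: measurable_funS mw => //.
    exact: sub.
  - apply/disj_setPS => x [/=]; rewrite 2!in_itv/= => /andP[_ yx] /andP[].
    by rewrite ltNge yx.
have fadd y z : u <= y -> y <= z -> z <= v ->
    \int[lebesgue_measure]_(x in `[u, z]) f x -
    \int[lebesgue_measure]_(x in `[u, y]) f x =
    \int[lebesgue_measure]_(x in `[y, z]) f x.
  move=> uy yz zv; rewrite Rintegral_itvB ?bnd_simp//; last first.
    by apply: integrableS intf => //; exact: sub.
  rewrite Rintegral_itv_obnd_cbnd//.
  by apply: integrableS intf => //; exact: sub'.
have step y z t : u <= y -> y <= t -> t <= z -> z <= v ->
    (forall x, x \in `[y, z] -> (`|f x - f t|%:E <= w x)%E) ->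
    `|F y - F t - f t * (y - t)| <= e' * `|y - t| ->
    `|F z - F t - f t * (z - t)| <= e' * `|z - t| ->
    `|Phi z - Phi y| <= Psi z - Psi y.
  move=> uy yt tz zv hw hy hz; have yz := le_trans yt tz.
  have hI : `|f t * (z - y) - \int[lebesgue_measure]_(x in `[y, z]) f x| <=
      fine (\int[lebesgue_measure]_(x in `[y, z]) w x).
    have mI : measurable (`[y, z]%classic : set R) by exact: measurable_itv.
    have intc : lebesgue_measure.-integrable `[y, z] (EFin \o cst (f t)).
      apply: continuous_compact_integrable; first exact: segment_compact.
      by apply: continuous_subspaceT => x; exact: cst_continuous.
    have intfyz : lebesgue_measure.-integrable `[y, z] (EFin \o f).
      by apply: integrableS intf => //; exact: sub.
    have intB : lebesgue_measure.-integrable `[y, z] (EFin \o (fun x => f t - f x)).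
      have := integrableB _ intc intfyz => /(_ mI).
      apply: eq_integrable => //.
    have <- : \int[lebesgue_measure]_(x in `[y, z]) (cst (f t) x) = f t * (z - y).
      rewrite Rintegral_cst//; congr (_ * _).
      rewrite [X in fine X]lebesgue_measure_itv/= lte_fin; case: ltP => // zy.
      by rewrite (@le_anti _ _ y z) ?yz// subrr.
    rewrite -RintegralB//; apply: (le_trans (le_normr_Rintegral _ _)) => //.
    apply: fine_le; rewrite ?Ifin//.
      by apply: integrable_fin_num => //; exact: (integrable_norm intB).
    apply: ge0_le_integral => //=.
    - by apply/measurable_EFinP/measurableT_comp => //;
        have /integrableP[/measurable_EFinP] := intB.
    - by apply: measurable_funS mw => //; exact: sub.
    - by move=> x xyz; rewrite distrC; exact: hw.
  have -> : Psi z - Psi y = fine (\int[lebesgue_measure]_(x in `[y, z]) w x)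
     + e' * (z - y) by rewrite /Psi -Wadd//; ring.
  have -> : Phi z - Phi y = (F z - F t - f t * (z - t)) - (F y - F t - f t * (y - t))
     + (f t * (z - y) - \int[lebesgue_measure]_(x in `[y, z]) f x).
    by rewrite /Phi -fadd//; ring.
  move: hy hz; rewrite (@ler0_norm _ (y - t)) ?subr_le0// (@ger0_norm _ (z - t)) ?subr_ge0//.
  set p := F y - _ - _; set q := F z - _ - _; set s := f t * _ - _ in hI *.
  move=> hy hz.
  have := ler_normD (q - p) s; have := ler_normB q p; lra.
have : `|Phi v - Phi u| <= Psi v - Psi u.
  apply: increment_le_of_local => // t tuv.
  have tuv' : t \in `[u, v] by rewrite in_itv.
  have near1 := filterI (ow t tuv') (derive1_linear_approx (dF t tuv') e'0).
  have /nbhs_ballP := near1 (nbhs_filter t).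
  move=> [d /= d0 hd].
  exists d => // y z /andP[uy yt] /andP[tz zv] yd zd.
  have inb x : y <= x -> x <= z -> ball t d x.
    move=> yx xz; rewrite /ball/= ltr_norml; lra.
  have yz := le_trans yt tz.
  apply: (step y z t) => //.
  - move=> x; rewrite in_itv/= => /andP[yx xz].
    have [h _] := hd _ (inb x yx xz); apply: h.
    by rewrite in_itv/= (le_trans uy)//= (le_trans xz).
  - by have [_] := hd _ (inb y (lexx _) yz).
  - by have [_] := hd _ (inb z yz (lexx _)).
rewrite /Phi /Psi set_itv1 Rintegral_set1 integral_set1/= subr0 add0r.
move=> h; rewrite addrAC; apply: (le_trans h).
have : fine (\int[lebesgue_measure]_(x in `[u, v]) w x) <= e'.
  by rewrite -lee_fin fineK// Ifin.
lra.
Qed.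

Lemma cvg_integral_nondecreasing_sets (d : measure_display)
    (T : measurableType d) (R : realType) (mu : {measure set T -> \bar R})
    (D : (set T)^nat) (f : T -> \bar R) :
  nondecreasing_seq D -> (forall n, measurable (D n)) ->
  mu.-integrable (\bigcup_n D n) f ->
  (\int[mu]_(x in D n) f x @[n --> \oo] --> \int[mu]_(x in \bigcup_n D n) f x)%E.
Proof.
move=> ndD mD intf.
have mf n : measurable_fun (D n) f.
  apply: measurable_funS (measurable_int _ intf); first exact: bigcup_measurable.
  exact: bigcup_sup.
rewrite integralE; under eq_fun do rewrite integralE.
apply: cvgeB.
- apply: fin_num_adde_defr.
  by apply: integrable_pos_fin_num => //; exact: bigcup_measurable.
- apply: ge0_nondecreasing_set_cvg_integral => // n; exact: measurable_funepos.
- apply: ge0_nondecreasing_set_cvg_integral => // n; exact: measurable_funeneg.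
Qed.

Section exhaustion.
Context {R : realType}.
Implicit Types (c : R).

(** The parameter c makes the family stable under the substitution
y |-> c / y, which maps [exhaust 1 n] onto [exhaust c n]. *)
Definition exhaust c (n : nat) : set R := `[c / n.+1%:R, c * n.+1%:R].

Lemma exhaust_nondecreasing c : 0 < c -> nondecreasing_seq (exhaust c).
Proof.
move=> c0; apply/nondecreasing_seqP => n; rewrite subsetEset.
apply: subset_itv; rewrite bnd_simp; last by rewrite ler_pM2l// ler_nat.
by rewrite ler_pM2l// lef_pV2 ?posrE// ler_nat.
Qed.

Lemma bigcup_exhaust c : 0 < c -> \bigcup_n exhaust c n = `]0, +oo[%classic.
Proof.
move=> c0; apply/seteqP; split => x /=.
  move=> [n _]; rewrite /exhaust /= !in_itv/= andbT => /andP[+ _].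
  by apply: lt_le_trans; rewrite divr_gt0.
rewrite in_itv/= andbT => x0.
pose n := Num.trunc (c / x + x / c).
have nP : c / x + x / c <= n.+1%:R by apply: ltW; exact: truncnS_gt.
have cx0 : 0 < c / x by rewrite divr_gt0.
have xc0 : 0 < x / c by rewrite divr_gt0.
exists n => //; rewrite /exhaust /= in_itv/=; apply/andP; split.
  rewrite ler_pdivrMr// mulrC -ler_pdivrMr//; lra.
rewrite mulrC -ler_pdivrMr//; lra.
Qed.

Lemma derivable_integrable_FTC0y (F f : R -> R) (l0 ly : R) :
  (forall x : R, 0 < x -> is_derive x 1 F (f x)) ->
  lebesgue_measure.-integrable `]0, +oo[ (EFin \o f) ->
  F x @[x --> 0^'+] --> l0 -> F x @[x --> +oo] --> ly ->
  (\int[lebesgue_measure]_(x in `]0%R, +oo[) (f x)%:E = (ly - l0)%:E)%E.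
Proof.
move=> dF intf F0 Fy.
have U1 := bigcup_exhaust (@ltr01 R).
have intn n : lebesgue_measure.-integrable (exhaust 1 n) (EFin \o f).
  apply: integrableS intf => //; first exact: measurable_itv.
  by rewrite -U1; exact: bigcup_sup.
rewrite -[in LHS]U1 -U1 in intf *.
have /cvg_lim <- // := @cvg_integral_nondecreasing_sets _ (measurableTypeR R) R
  lebesgue_measure _ _ (exhaust_nondecreasing ltr01) (fun=> measurable_itv _) intf.
apply/cvg_lim => //.
have E n : (\int[lebesgue_measure]_(x in exhaust 1 n) (EFin \o f) x =
    (F n.+1%:R - F n.+1%:R^-1)%:E)%E.
  have le1 : (n.+1%:R^-1 : R) <= n.+1%:R.
    by rewrite (@le_trans _ _ 1)// ?invf_le1 ?ler1n.
  have dFn (t : R) : t \in `[n.+1%:R^-1, n.+1%:R] -> is_derive t 1 F (f t).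
    rewrite in_itv/= => /andP[nt _]; apply: dF.
    by apply: lt_le_trans nt; rewrite invr_gt0.
  have := intn n; rewrite /exhaust !mul1r => int1.
  rewrite -(derivable_integrable_FTC2 le1 dFn int1) /Rintegral fineK//.
  exact: integrable_fin_num.
under eq_fun do rewrite E.
apply: cvg_EFin; first exact: nearW.
apply: cvgB.
  apply: cvg_comp Fy; apply/cvgryPge => r.
  exists (Num.trunc r) => // n /= rn; apply: ltW; apply: lt_le_trans (truncnS_gt _) _.
  by rewrite ler_nat.
move/cvg_at_rightP : F0; apply; split => [n|]; first by rewrite invr_gt0.
exact: cvg_harmonic.
Qed.

End exhaustion.

(** * The unnormalised density *)

Definition gig_kernel {R : realType} (p a b x : R) : R :=
  x `^ (p - 1) * expR (- (a * x + b / x) / 2).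

Section gig_kernel.
Context {R : realType}.
Variables p a b : R.
Let k := gig_kernel p a b.

Lemma gig_kernel_gt0 x : 0 < x -> 0 < k x.
Proof. by move=> x0; rewrite mulr_gt0 ?powR_gt0 ?expR_gt0. Qed.

Lemma is_derive_gig_kernel (x : R) : 0 < x ->
  is_derive x 1 k (((p - 1) / x + b / (2 * x ^+ 2) - a / 2) * k x).
Proof.
move=> x0; have xn0 : x != 0 by rewrite gt_eqF.
have dV : is_derive x 1 (fun y : R => y^-1) (- x ^- 2).
  apply: is_derive_eq; first exact: (@is_deriveV _ id).
  by rewrite /GRing.scale/= mulr1.
have dE : is_derive x 1 (fun y : R => - (a * y + b / y) / 2)
    (- (a - b / x ^+ 2) / 2).
  apply: is_derive_eq.
  rewrite /GRing.scale/=; field; exact: xn0.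
have dP := is_derive1_powR (p - 1) x0.
have dEE : is_derive x 1 (fun y : R => expR (- (a * y + b / y) / 2))
   (expR (- (a * x + b / x) / 2) * (- (a - b / x ^+ 2) / 2)).
  exact: is_derive1_comp.
have -> : k = (fun y : R => y `^ (p - 1)) * (fun y => expR (- (a * y + b / y) / 2)).
  exact/funext.
apply: is_derive_eq.
rewrite /GRing.scale/=.
rewrite [RHS](_ : _ = ((p - 1) / x + b / (2 * x ^+ 2) - a / 2) *
  (x `^ (p - 1) * expR (- (a * x + b / x) / 2)))//.
rewrite (@powRB _ x (p - 1) 1) ?xn0 ?implybT// powRr1 ?ltW//.
field; exact: xn0.
Qed.

Lemma continuous_gig_kernel (x : R) : 0 < x -> {for x, continuous k}.
Proof.
move=> /is_derive_gig_kernel[dk _].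
by apply/differentiable_continuous/derivable1_diffP.
Qed.

Lemma measurable_gig_kernel : measurable_fun (`]0, +oo[ : set R) k.
Proof.
apply: open_continuous_measurable_fun => // x.
by rewrite inE/= in_itv/= andbT; exact: continuous_gig_kernel.
Qed.

End gig_kernel.

(** A multiple q of the logarithm is absorbed by c x when q >= 0 and by e / x
when q < 0, the two cases being exchanged by x |-> 1 / x. *)
Lemma mul_ln_le (R : realType) (q c x e : R) : 0 < c -> 0 < e -> 0 < x ->
  q * ln x <= c * x + e / x + `|q| * (ln (`|q| / c + 1) + ln (`|q| / e + 1)).
Proof.
move=> c0 e0 x0.
wlog : q x e c c0 e0 x0 / 0 <= q => [hw|q0].
  have [|/ltW q0] := leP 0 q; first exact: hw.
  have := hw (- q) x^-1 c e e0 c0; rewrite invr_gt0 oppr_ge0 lnV// => /(_ x0 q0).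
  by rewrite invrK mulrNN normrN; lra.
rewrite ger0_norm//.
have ex : 0 <= e / x by rewrite divr_ge0// ltW.
have l0 : 0 <= q * ln (q / e + 1).
  by rewrite mulr_ge0// ln_ge0// lerDr divr_ge0// ltW.
(* ln x = ln (x / s) + ln s <= x / s - 1 + ln s with s = q / c + 1, a value for
   which q / s <= c *)
have s0 : 0 < q / c + 1 by rewrite ltr_wpDl// divr_ge0// ltW.
have h : ln x <= x / (q / c + 1) - 1 + ln (q / c + 1).
  rewrite -[x in ln x](divfK (lt0r_neq0 s0)) lnM ?posrE ?divr_gt0// lerD2r.
  set y := x / _; have y0 : 0 < y by rewrite divr_gt0.
  have -> : ln y = ln (1 + (y - 1)) by congr ln; ring.
  by apply: le_ln1Dx; rewrite ltrBrDl subrr.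
have h2 : q * (x / (q / c + 1)) <= c * x.
  rewrite mulrA ler_pdivrMr// mulrAC ler_wpM2r ?(ltW x0)// ltW//.
  by rewrite mulrDr mulr1 mulrCA divff ?gt_eqF// mulr1 ltrDl.
have := ler_wpM2l q0 h; rewrite mulrDr mulrBr mulr1; lra.
Qed.

Section gig_normalization.
Context {R : realType}.
Variables (p a b : R).
Hypotheses (a0 : 0 < a) (b0 : 0 < b).
Let mu := @lebesgue_measure R.
Let k := gig_kernel p a b.

(** By [mul_ln_le], e^(a x / 4 + b / (2 x)) dominates the power x^(p-1) up to a
constant; what is left of the exponential factor, e^(-a x / 4), is a multiple
of an exponential density. *)
Lemma integrable_gig_kernel : mu.-integrable `]0, +oo[ (EFin \o k).
Proof.
have a2 : 0 < a / 4 by rewrite divr_gt0.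
have b2 : 0 < b / 2 by rewrite divr_gt0.
set M := `|p - 1| * (ln (`|p - 1| / (a / 4) + 1) + ln (`|p - 1| / (b / 2) + 1)).
have kM x : 0 < x -> k x <= expR M / (a / 4) * exponential_pdf (a / 4) x.
  move=> x0; rewrite exponential_pdfE ?(ltW x0)// mulrA divfK ?gt_eqF//.
  rewrite /k /gig_kernel /powR gt_eqF// -!expRD ler_expR.
  have := mul_ln_le (p - 1) a2 b2 x0; rewrite -/M.
  rewrite mulrAC; lra.
have intE : mu.-integrable `]0, +oo[
    (fun x => (expR M / (a / 4))%:E * (exponential_pdf (a / 4) x)%:E)%E.
  apply: integrableZl => //.
  by apply: integrableS (integrable_exponential_pdf a2).
apply: le_integrable intE => //.
  by apply/measurable_EFinP; exact: measurable_gig_kernel.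
move=> x /=; rewrite in_itv/= andbT => x0.
rewrite lee_fin ger0_norm; last by rewrite ltW// gig_kernel_gt0.
by rewrite (le_trans (kM x x0))// ler_norm.
Qed.

Definition gig_mass := \int[mu]_(x in `]0, +oo[) k x.

Lemma gig_massE : (gig_mass%:E = \int[mu]_(x in `]0%R, +oo[) (k x)%:E)%E.
Proof.
rewrite /gig_mass /Rintegral fineK//; apply: integrable_fin_num => //.
exact: integrable_gig_kernel.
Qed.

(** A positive function with zero integral over ]0, +oo[ would vanish almost
everywhere on a set of infinite measure. *)
Lemma gig_mass_gt0 : 0 < gig_mass.
Proof.
have k0 x : x \in `]0, +oo[ -> 0 < k x.
  by rewrite in_itv/= andbT; exact: gig_kernel_gt0.
have mk : measurable_fun (`]0, +oo[%classic : set R) (EFin \o k).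
  by apply/measurable_EFinP; exact: measurable_gig_kernel.
rewrite lt0r Rintegral_ge0 ?andbT; last by move=> x /k0/ltW.
apply/eqP => m0.
have : (\int[mu]_(x in `]0%R, +oo[) `|(EFin \o k) x| = 0)%E.
  transitivity gig_mass%:E; last by rewrite m0.
  rewrite gig_massE; apply: eq_integral => x.
  by rewrite inE => /k0 kx; rewrite /= gtr0_norm.
move/(ae_eq_integral_abs mu _ mk) => /(_ (measurable_itv _)) [N [mN N0 subN]].
have muy : lebesgue_measure (`]0, +oo[%classic : set R) = +oo%E.
  by rewrite lebesgue_measure_itv/= ltry.
have N0' : lebesgue_measure N = 0%E by exact: N0.
suff : (lebesgue_measure (`]0%R, +oo[%classic : set R) <= lebesgue_measure N)%E.
  by rewrite muy N0'.
apply: le_measure; rewrite ?inE; [exact: measurable_itv|exact: mN|].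
move=> x x0; apply: subN => /= /(_ x0)[] /eqP.
by rewrite gt_eqF// k0.
Qed.

End gig_normalization.

(** * The Bessel function as normalising constant *)

Section bessel.
Context {R : realType}.
Variables (p a b : R).
Hypotheses (a0 : 0 < a) (b0 : 0 < b).
Let mu := @lebesgue_measure R.

Definition bessel_kernel (p z x : R) : R :=
  x `^ (- p - 1) * expR (- x - z ^+ 2 / (4 * x)).

(** The pointwise identity behind the substitution x = b / (2 y): the factor
b / (2 y^2) is the absolute value of the Jacobian. *)
Lemma bessel_kernel_div x : 0 < x ->
  bessel_kernel p (Num.sqrt (a * b)) (b / 2 / x) * (b / 2 / x ^+ 2) =
  (b / 2) `^ (- p) * gig_kernel p a b x.
Proof.
move=> x0; have xn0 : x != 0 by rewrite gt_eqF.
have bn0 : b != 0 by rewrite gt_eqF.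
have c0 : 0 < b / 2 by rewrite divr_gt0.
rewrite /bessel_kernel /gig_kernel sqr_sqrtr ?mulr_ge0 ?(ltW a0) ?(ltW b0)//.
have -> : - (b / 2 / x) - a * b / (4 * (b / 2 / x)) = - (a * x + b / x) / 2.
  by field; rewrite xn0 bn0.
rewrite powRM ?invr_ge0 ?(ltW c0) ?(ltW x0)//.
have -> : x^-1 `^ (- p - 1) = x `^ (p - 1) * x ^+ 2.
  rewrite -powR_inv1 ?(ltW x0)// -powRrM -powR_mulrn ?(ltW x0)// -powRD ?xn0 ?implybT//.
  by congr powR; ring.
rewrite (@powRB _ (b / 2) (- p) 1) ?(gt_eqF c0) ?implybT// powRr1 ?(ltW c0)//.
by field; rewrite xn0 bn0.
Qed.

Lemma continuous_bessel_kernel (z x : R) : 0 < x -> {for x, continuous (bessel_kernel p z)}.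
Proof.
move=> x0; have xn0 : x != 0 by rewrite gt_eqF.
have dP := is_derive1_powR (- p - 1) x0.
have n0 : 4 * x != 0 by rewrite mulf_neq0.
have dE : derivable (fun y : R => - y - z ^+ 2 / (4 * y)) x 1.
  by apply: ex_derive.
apply: continuousM.
  apply/differentiable_continuous/derivable1_diffP.
  by case: dP.
apply: (continuous_comp (g := expR)).
  by apply/differentiable_continuous/derivable1_diffP.
exact: continuous_expR.
Qed.

(** The substitution is performed on the compact intervals of the exhaustion,
where everything is continuous, and monotone convergence passes to the
limit. *)
Lemma integral_bessel_kernel :
  (\int[mu]_(x in `]0%R, +oo[) (bessel_kernel p (Num.sqrt (a * b)) x)%:E =
   ((b / 2) `^ (- p) * gig_mass p a b)%:E)%E.
Proof.
set G := bessel_kernel _ _.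
have c0 : 0 < b / 2 by rewrite divr_gt0.
have G0 x : 0 < x -> 0 <= G x.
  by move=> x0; rewrite mulr_ge0 ?powR_ge0 ?expR_ge0.
have n0 n : 0 < n.+1%:R :> R by [].
have subn (c : R) n : 0 < c -> exhaust c n `<=` `]0, +oo[%classic.
  by move=> cc0; rewrite -(bigcup_exhaust cc0); exact: bigcup_sup.
have mG : measurable_fun (`]0, +oo[%classic : set R) G.
  apply: open_continuous_measurable_fun => // x.
  by rewrite inE/= in_itv/= andbT; exact: continuous_bessel_kernel.
have E n : (\int[mu]_(x in exhaust (b / 2) n) (G x)%:E =
    ((b / 2) `^ (- p))%:E * \int[mu]_(x in exhaust 1 n) (gig_kernel p a b x)%:E)%E.
  pose F (y : R) := b / 2 / y.
  have dF (y : R) : 0 < y -> is_derive y 1 F (- (b / 2 / y ^+ 2)).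
    move=> y0; have yn0 : y != 0 by rewrite gt_eqF.
    have dV : is_derive y 1 (fun y : R => y^-1) (- y ^- 2).
      apply: is_derive_eq; first exact: (@is_deriveV _ id).
      by rewrite /GRing.scale/= mulr1.
    apply: is_derive_eq; rewrite /GRing.scale/=; field; exact: yn0.
  have dF1 (y : R) : 0 < y -> derive1 F y = - (b / 2 / y ^+ 2).
    by move=> /dF h; rewrite derive1E derive_val.
  have cF1 (y : R) : 0 < y -> {for y, continuous (derive1 F)}.
    move=> y0; have yn0 : y != 0 by rewrite gt_eqF.
    have H : {for y, continuous (fun y : R => - (b / 2 / y ^+ 2))}.
      apply: cvgN; apply: cvgM; first exact: cvg_cst.
      by apply: cvgV; [rewrite expf_neq0|exact: exprn_continuous].
    rewrite /prop_for /continuous_at dF1//.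
    apply: cvg_trans H; apply: near_eq_cvg; near=> t; rewrite dF1//.
    by near: t; exact: lt_nbhsr.
  have le1 : (n.+1%:R^-1 : R) <= n.+1%:R.
    by rewrite (@le_trans _ _ 1)// ?invf_le1 ?ler1n.
  have v0 : 0 < n.+1%:R^-1 :> R by rewrite invr_gt0.
  have := @integration_by_substitution_decreasing R F G _ _ le1.
  rewrite /exhaust !mul1r -/(F n.+1%:R) /F invrK -/F => ->.
  - rewrite -ge0_integralZl//=.
    + apply: eq_integral => x; rewrite inE/= in_itv/= => /andP[nx _].
      have x0 : 0 < x by apply: lt_le_trans nx.
      have -> : ((G \o F) * - derive1 F) x = G (F x) * - derive1 F x by [].
      by rewrite -EFinM -bessel_kernel_div// dF1// opprK.
    + apply/measurable_EFinP; apply: measurable_funS (measurable_gig_kernel p a b) => //.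
      by have := subn 1 n ltr01; rewrite /exhaust !mul1r.
    + move=> x; rewrite in_itv/= => /andP[nx _].
      by rewrite lee_fin ltW// gig_kernel_gt0// (lt_le_trans v0).
    + by rewrite lee_fin powR_ge0.
  - move=> x y; rewrite !in_itv/= => /andP[nx _] /andP[ny _] xy.
    by rewrite /F ltr_pM2l// ltf_pV2 ?posrE ?(lt_le_trans v0).
  - by move=> x; rewrite in_itv/= => /andP[nx _]; apply/cF1/(lt_trans v0).
  - by apply/cvg_ex; eexists; apply: cvg_at_right_filter; exact: (cF1 _ v0).
  - by apply/cvg_ex; eexists; apply: cvg_at_left_filter; exact: (cF1 _ (n0 n)).
  - have cF (y : R) : 0 < y -> {for y, continuous F}.
      by move=> /dF[? _]; apply/differentiable_continuous/derivable1_diffP.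
    split.
    + by move=> x; rewrite in_itv/= => /andP[nx _]; have [] := dF _ (lt_trans v0 nx).
    + exact/cvg_at_right_filter/cF.
    + exact/cvg_at_left_filter/cF.
  - apply: continuous_in_subspaceT => x; rewrite inE/= in_itv/= => /andP[nx _].
    by apply: continuous_bessel_kernel; apply: lt_le_trans nx; rewrite divr_gt0.
have cvgG := @ge0_nondecreasing_set_cvg_integral _ (measurableTypeR R) R _ (EFin \o G) mu
  (exhaust_nondecreasing c0) (fun=> measurable_itv _).
have cvgk := @ge0_nondecreasing_set_cvg_integral _ (measurableTypeR R) R _
  (EFin \o gig_kernel p a b) mu (exhaust_nondecreasing ltr01) (fun=> measurable_itv _).
rewrite !bigcup_exhaust// in cvgG cvgk.
have {}cvgG : (\int[mu]_(x in exhaust (b / 2) n) (G x)%:E @[n --> \oo] -->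
    \int[mu]_(x in `]0%R, +oo[) (G x)%:E)%E.
  apply: cvgG => [n|n x].
    by apply/measurable_EFinP; apply: measurable_funS mG => //; exact: subn.
  by move=> /(subn _ _ c0); rewrite /= in_itv/= andbT lee_fin; exact: G0.
have {}cvgk : (\int[mu]_(x in exhaust 1 n) (gig_kernel p a b x)%:E @[n --> \oo] -->
    \int[mu]_(x in `]0%R, +oo[) (gig_kernel p a b x)%:E)%E.
  apply: cvgk => [n|n x].
    apply/measurable_EFinP; apply: measurable_funS (measurable_gig_kernel p a b) => //.
    exact: subn.
  move=> /(subn _ _ ltr01); rewrite /= in_itv/= andbT lee_fin => x0.
  by rewrite ltW// gig_kernel_gt0.
rewrite EFinM gig_massE//.
move: cvgG; under eq_fun do rewrite E.
move=> cvgG; apply: (cvg_unique _ cvgG) => //.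
exact: cvgeZl.
Unshelve. all: by end_near. Qed.

Lemma besselK_gig_mass :
  2 * besselK p (Num.sqrt (a * b)) = (a / b) `^ (p / 2) * gig_mass p a b.
Proof.
have c0 : 0 < b / 2 by rewrite divr_gt0.
rewrite /besselK.
have -> : \int[lebesgue_measure]_(x in `]0, +oo[)
    (x `^ (- p - 1) * expR (- x - Num.sqrt (a * b) ^+ 2 / (4 * x))) =
    (b / 2) `^ (- p) * gig_mass p a b.
  by rewrite [LHS]/Rintegral integral_bessel_kernel.
rewrite -powR12_sqrt ?mulr_ge0 ?(ltW a0) ?(ltW b0)// -powRrM (mulrC 2^-1).
rewrite (@powRB _ 2 (- p) 1) ?pnatr_eq0 ?implybT// powRr1//.
rewrite !powRM ?invr_ge0 ?(ltW a0) ?(ltW b0)//.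
have -> : b^-1 `^ (p / 2) = b `^ (p / 2) * b `^ (- p).
  rewrite -powR_inv1 ?(ltW b0)// -powRrM -powRD ?(gt_eqF b0) ?implybT//.
  by congr powR; field.
have -> : 2^-1 `^ (- p) = (2 `^ (- p))^-1 :> R.
  by rewrite -powR_inv1// -powRrM mulrC powRrM powR_inv1 ?powR_ge0.
have : 2 `^ (- p) != 0 :> R by rewrite gt_eqF// powR_gt0.
by move: (2 `^ (- p)) => t t0; field.
Qed.

Lemma gig_pdfE :
  gig_pdf p a b = (fun x => gig_kernel p a b x / gig_mass p a b) \_ `]0, +oo[.
Proof.
rewrite /gig_pdf; congr (_ \_ _); apply/funext => x.
rewrite besselK_gig_mass -mulrA -/(gig_kernel p a b x).
have : (a / b) `^ (p / 2) != 0 by rewrite gt_eqF// powR_gt0// divr_gt0.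
have : gig_mass p a b != 0 by rewrite gt_eqF// gig_mass_gt0.
by move: (_ `^ _) (gig_mass _ _ _) (gig_kernel _ _ _ _) => s t u s0 t0;
  field; rewrite s0 t0.
Qed.

End bessel.

(** * Laws with a density *)

Section density.
Context {R : realType}.
Let mu := @lebesgue_measure R.
Variables (nu : probability (measurableTypeR R) R) (f : R -> R).
Hypothesis intf : mu.-integrable setT (EFin \o f).
Hypothesis f0 : forall x, 0 <= f x.

(** By uniqueness of Radon-Nikodym derivatives, f is the derivative of nu with
respect to the Lebesgue measure. *)
Lemma integral_density :
  (forall A, measurable A -> nu A = \int[mu]_(x in A) (f x)%:E)%E ->
  forall phi : measurableTypeR R -> \bar R, nu.-integrable setT phi ->
  (\int[nu]_x phi x = \int[mu]_x (phi x * (f x)%:E))%E.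
Proof.
move=> nuE phi intphi.
have mEf : measurable_fun setT (EFin \o f) := measurable_int _ intf.
have dom : nu `<< mu.
  apply/null_content_dominatesP => A mA muA0; rewrite nuE//.
  by apply: null_set_integral => //; exact: measurable_funTS.
rewrite -(Radon_Nikodym_change_of_variables dom)//=.
have mphi := measurable_int _ intphi.
apply: ae_eq_integral => //.
- exact: emeasurable_funM.
- exact: emeasurable_funM.
- apply: ae_eqe_mul2l => /=.
  rewrite Radon_NikodymE.
  case: cid => /= h [h1 h2 h3].
  apply: integral_ae_eq => //=.
  by move=> E E01 mE; rewrite -h3//= nuE.
Qed.

(** The rays ]-oo, t[ are stable under intersection and generate the Borel
sets. *)
Lemma density_eq_of_rays :
  (forall t : R, (nu `]-oo, t[%classic = \int[mu]_(x in `]-oo, t[) (f x)%:E)%E) ->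
  forall A, measurable A -> (nu A = \int[mu]_(x in A) (f x)%:E)%E.
Proof.
move=> H A mA.
pose m (B : set (measurableTypeR R)) := (\int[mu]_(x in B) (f x)%:E)%E.
have m0 : m set0 = 0%E by rewrite /m integral_set0.
have mge0 B : (0 <= m B)%E by apply: integral_ge0 => x _; rewrite lee_fin.
have msig : semi_sigma_additive m.
  move=> /= B mB tB mUB; rewrite /m integral_bigcup//=; last first.
    exact: integrableS intf.
  by apply: is_cvg_ereal_nneg_natsum_cond => n _ _; exact: mge0.
pose M : {measure set (measurableTypeR R) -> \bar R} :=
  HB.pack m (isMeasure.Build _ (measurableTypeR R) R m m0 mge0 msig).
change (nu A = M A).
apply: (@measure_unique _ R (measurableTypeR R)
  [set B | exists t : R, B = `]-oo, t[%classic]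
  (fun n => `]-oo, n%:R[%classic) _ _ _ _ nu M) => //.
- exact: RGenInftyO.measurableE.
- move=> _ _ [s ->] [t ->]; exists (Num.min s t).
  by apply/seteqP; split => x /=; rewrite !in_itv/= lt_min => /andP.
- by move=> n; exists n%:R.
- apply/seteqP; split => // x _; exists (Num.trunc x).+1 => //=.
  by rewrite in_itv/= truncnS_gt.
- by move=> _ [t ->]; exact: H.
- by move=> n; rewrite -ge0_fin_numE// fin_num_measure.
Qed.

Lemma integrable_mul_density (g : R -> R) : continuous g ->
  (forall x, 0 <= g x <= 1) ->
  mu.-integrable setT (EFin \o (fun x => g x * f x)).
Proof.
move=> cg g01; apply: le_integrable (intf) => //.
  apply/measurable_EFinP; apply: measurable_funM.
    exact: continuous_measurable_fun.
  by apply/measurable_EFinP; exact: measurable_int intf.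
move=> x _; have /andP[? ?] := g01 x.
by rewrite lee_fin !ger0_norm ?mulr_ge0// ler_piMl.
Qed.

(** The clipped affine functions g n below increase to the indicator of ]-oo, t[, so
that dominated convergence reduces the statement to [density_eq_of_rays]. *)
Lemma density_eq_of_continuous :
  (forall g : R -> R, continuous g -> (forall x, 0 <= g x <= 1) ->
     (\int[nu]_x (g x)%:E = \int[mu]_x (g x * f x)%:E)%E) ->
  forall A, measurable A -> (nu A = \int[mu]_(x in A) (f x)%:E)%E.
Proof.
move=> H; apply: density_eq_of_rays => t.
pose g n (x : R) := Num.min 1 (Num.max 0 (n%:R * (t - x))) : R.
have g01 n x : 0 <= g n x <= 1.
  by rewrite /g ge_min lexx/= le_min ler01 le_max lexx.
have cg n : continuous (g n).
  have -> : g n = (cst 1 : R -> R^o) \min ((cst 0 : R -> R^o) \max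
    (fun x => n%:R * (t - x))) by [].
  move=> x; apply: continuous_min; first exact: cst_continuous.
  apply: continuous_max; first exact: cst_continuous.
  by apply: cvgM; [exact: cvg_cst|apply: cvgB; [exact: cvg_cst|exact: cvg_id]].
have mg n : measurable_fun (setT : set (measurableTypeR R)) (g n).
  exact: continuous_measurable_fun.
have gcvg x : g n x @[n --> \oo] --> (\1_(`]-oo, t[) x : R).
  rewrite indicE; have [xt|tx] := ltP x t; last first.
    rewrite memNset/=; last by rewrite in_itv/= ltNge tx.
    rewrite (_ : (fun n => g n x) = cst 0); first exact: cvg_cst.
    apply/funext => n; rewrite /g max_l ?min_r//.
    by rewrite mulr_ge0_le0// subr_le0.
  rewrite mem_set/=; last by rewrite in_itv/= xt.
  apply: cvg_near_cst; near=> n; rewrite /g min_l// le_max -ler_pdivrMr ?subr_gt0//.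
  by apply/orP; right; near: n; exact: nbhs_infty_ger.
have E1 : (\int[nu]_x (g n x)%:E @[n --> \oo] --> nu `]-oo, t[%classic)%E.
  rewrite -[X in _ --> nu X]setIT -(integral_indic nu measurableT)//.
  apply: (@dominated_cvg _ _ _ nu setT measurableT _ _ (EFin \o cst 1)) => //.
  - by move=> n; exact/measurable_EFinP.
  - by move=> x _; apply: cvg_EFin; [exact: nearW|exact: gcvg].
  - exact: finite_measure_integrable_cst.
  - move=> n x _; have /andP[? ?] := g01 n x.
    by rewrite lee_fin ger0_norm.
have E2 : (\int[mu]_x (g n x * f x)%:E @[n --> \oo] -->
    \int[mu]_(x in `]-oo, t[) (f x)%:E)%E.
  rewrite integral_mkcond.
  apply: (@dominated_cvg _ _ _ mu setT measurableT _ _ (EFin \o f)) => //.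
  - move=> n; apply/measurable_EFinP; apply: measurable_funM => //.
    by apply/measurable_EFinP; exact: measurable_int intf.
  - move=> x _; rewrite (_ : _ x = (\1_(`]-oo, t[) x * f x)%:E).
      apply: cvg_EFin; first exact: nearW.
      by apply: cvgM; [exact: gcvg|exact: cvg_cst].
    by rewrite patchE indicE; case: ifPn; rewrite ?mul1r// mul0r.
  - move=> n x _; have /andP[? ?] := g01 n x.
    by rewrite lee_fin ger0_norm ?mulr_ge0// ler_piMl.
apply: (cvg_unique _ E1) => //; apply: cvg_trans E2.
by apply: near_eq_cvg; near=> n; apply/esym; exact: H.
Unshelve. all: by end_near. Qed.

End density.

(** * The GIG density *)

Section gig_pdf.
Context {R : realType}.
Variables (p a b : R).
Hypotheses (a0 : 0 < a) (b0 : 0 < b).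
Let mu := @lebesgue_measure R.
Let f := gig_pdf p a b.
Let m0 := gig_mass_gt0 p a0 b0.

Lemma gig_pdf_gt0E (x : R) : 0 < x -> f x = gig_kernel p a b x / gig_mass p a b.
Proof. by move=> x0; rewrite /f gig_pdfE// patchE mem_set//= in_itv/= x0. Qed.

Lemma gig_pdf_le0E (x : R) : x <= 0 -> f x = 0.
Proof. by move=> x0; rewrite /f /gig_pdf patchE memNset//= in_itv/= ltNge x0. Qed.

Lemma gig_pdf_gt0 (x : R) : 0 < x -> 0 < f x.
Proof. by move=> x0; rewrite gig_pdf_gt0E// divr_gt0// gig_kernel_gt0. Qed.

Lemma gig_pdf_ge0 (x : R) : 0 <= f x.
Proof.
by have [/gig_pdf_le0E ->//|/gig_pdf_gt0/ltW] := leP x 0.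
Qed.

Lemma is_derive_gig_pdf (x : R) : 0 < x ->
  is_derive x 1 f (((p - 1) / x + b / (2 * x ^+ 2) - a / 2) * f x).
Proof.
move=> x0.
have H : is_derive x 1 (fun y => gig_kernel p a b y / gig_mass p a b)
   (((p - 1) / x + b / (2 * x ^+ 2) - a / 2) * f x).
  have dk := is_derive_gig_kernel p a b x0.
  apply: is_derive_eq.
  by rewrite gig_pdf_gt0E// /GRing.scale/=; ring.
apply: near_eq_is_derive H.
by near=> y; rewrite gig_pdf_gt0E//; near: y; exact: lt_nbhsr.
Unshelve. all: by end_near. Qed.

Lemma integrable_gig_pdf : mu.-integrable setT (EFin \o f).
Proof.
have : mu.-integrable `]0, +oo[
    (fun x => (gig_mass p a b)^-1%:E * (gig_kernel p a b x)%:E)%E.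
  by apply: integrableZl => //; exact: integrable_gig_kernel.
move=> H; rewrite /f gig_pdfE// -restrict_EFin.
apply/integrable_restrict => //=; rewrite setTI.
by apply: eq_integrable H => //= x _; rewrite mulrC.
Qed.

Lemma integral_gig_pdf : (\int[mu]_x (f x)%:E = 1)%E.
Proof.
transitivity (\int[mu]_(x in `]0%R, +oo[)
  ((gig_mass p a b)^-1%:E * (gig_kernel p a b x)%:E))%E.
  rewrite [RHS]integral_mkcond; apply: eq_integral => x _.
  rewrite patchE; case: ifPn => [|].
    by rewrite inE/= in_itv/= andbT => x0; rewrite gig_pdf_gt0E// mulrC.
  rewrite notin_setE/= in_itv/= andbT => /negP; rewrite -leNgt => x0.
  by rewrite gig_pdf_le0E.
rewrite integralZl//; last exact: integrable_gig_kernel.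
by rewrite -gig_massE// -EFinM mulVf// gt_eqF.
Qed.

End gig_pdf.

(** * The Stein operator *)

(** A derivative is a pointwise limit of the difference quotients of step
1 / (n + 1). *)
Lemma measurable_derive1 (R : realType) (h : R -> R) :
  (forall x : R, 0 < x -> derivable h x 1) ->
  measurable_fun (`]0, +oo[%classic : set R) (derive1 h).
Proof.
move=> dh.
have mh (c : R) : 0 <= c -> measurable_fun (`]0, +oo[%classic : set R) (fun x => h (c + x)).
  move=> c0; apply: open_continuous_measurable_fun => // x.
  rewrite inE/= in_itv/= andbT => x0.
  apply: continuous_comp; first by apply: cvgD; [exact: cvg_cst|exact: cvg_id].
  by apply/differentiable_continuous/derivable1_diffP/dh; rewrite ltr_wpDl.
apply: (@measurable_fun_cvg _ R R _
  (fun n x => n.+1%:R * (h (n.+1%:R^-1 + x) - h (0 + x))) (derive1 h)) => [n|x].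
  apply: measurable_funM => //.
  by apply: measurable_funB; apply: mh.
rewrite /= in_itv/= andbT => x0.
have /cvg_ex[l hl] := dh x x0.
have -> : derive1 h x = l.
  by rewrite derive1E; exact: (cvg_lim (@Rhausdorff R) hl).
move/cvgr_dnbhsP : hl => /(_ (fun n => n.+1%:R^-1)) H.
have {}H := H (conj (fun n => lt0r_neq0 (_ : 0 < n.+1%:R^-1)) (@cvg_harmonic R)).
have {}H := H (fun n => ltac:(by rewrite invr_gt0)).
apply: cvg_trans H; apply: near_eq_cvg; near=> n.
by rewrite /= invrK add0r /GRing.scale/= mulr1.
Unshelve. all: by end_near. Qed.

Lemma integral_itv0y_cvg (R : realType) (u : R -> R) :
  lebesgue_measure.-integrable setT (EFin \o u) ->
  (forall x, x < 0 -> u x = 0) -> \int[lebesgue_measure]_x u x = 0 ->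
  \int[lebesgue_measure]_(t in `[0, x]) u t @[x --> +oo] --> 0.
Proof.
move=> intu u0 Iu; rewrite -[X in _ --> X]Iu; apply/cvg_pinftyP => y yy.
apply: fine_cvg; rewrite -/(Rintegral _ _ _) [X in _ --> X]fineK; last first.
  exact: integrable_fin_num.
under eq_fun do rewrite integral_mkcond.
have mu_ := measurable_int _ intu.
apply: (@dominated_cvg _ _ _ lebesgue_measure setT measurableT _ _ (abse \o (EFin \o u))) => //.
- by move=> n; apply/(measurable_restrictT _ _).1 => //; exact: measurable_funTS.
- move=> x _; have [x0|x0] := ltP x 0.
    rewrite u0//; under eq_fun do rewrite patchE/= u0// if_same.
    exact: cvg_cst.
  apply: cvg_near_cst; near=> n; rewrite patchE mem_set//= in_itv/= x0/=.
  by near: n; move/cvgryPge : yy; exact.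
- exact: integrable_abse.
- by move=> n x _; rewrite patchE; case: ifP => _ //=; rewrite normr0 lee_fin.
Unshelve. all: by end_near. Qed.

Lemma measurable_gig_stein (R : realType) (p a b : R) (h : R -> R) :
  (forall x : R, 0 < x -> derivable h x 1) ->
  measurable_fun (`]0, +oo[%classic : set R) (gig_stein p a b h).
Proof.
move=> dh; apply: measurable_funD; first exact: measurable_derive1.
apply: open_continuous_measurable_fun => // x.
rewrite inE/= in_itv/= andbT => x0; have xn0 : x != 0 by rewrite gt_eqF.
have cV : {for x, continuous (fun y : R => y^-1)} by exact: inv_continuous.
have cV2 : {for x, continuous (fun y : R => (2 * y ^+ 2)^-1)}.
  apply: cvgV; first by rewrite mulf_neq0 ?expf_neq0.
  by apply: cvgM; [exact: cvg_cst|exact: exprn_continuous].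
apply: cvgM; last by apply/differentiable_continuous/derivable1_diffP/dh.
apply: cvgB; last exact: cvg_cst.
by apply: cvgD; apply: cvgM => //; exact: cvg_cst.
Qed.

Section gig_stein.
Context {R : realType}.
Variables (p a b : R).
Hypotheses (a0 : 0 < a) (b0 : 0 < b).
Let mu := @lebesgue_measure R.
Let f := gig_pdf p a b.

(** The integrand is the derivative of f h. *)
Lemma integral_gig_stein_eq0 (h : R -> R) : gig_test_function p a b h ->
  mu.-integrable `]0, +oo[ (EFin \o (fun x => gig_stein p a b h x * f x)) ->
  (\int[mu]_(x in `]0%R, +oo[) (gig_stein p a b h x * f x)%:E = 0)%E.
Proof.
move=> [dh hy h0] ints.
rewrite (derivable_integrable_FTC0y _ ints h0 hy) ?subrr// => x x0.
have df := is_derive_gig_pdf p a0 b0 x0.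
have dhx : is_derive x 1 h (derive1 h x).
  by rewrite derive1E; apply: derivableP; exact: dh.
rewrite (_ : (fun y => _) = gig_pdf p a b * h)//; apply: is_derive_eq.
by rewrite /gig_stein /GRing.scale/= -/f; ring.
Qed.

(** The solution is h x = (1 / f x) \int_0^x (g - m) f.  The choice of m makes
the integral of (g - m) f over ]0, +oo[ vanish, which is the boundary condition
at infinity.  The last clause describes the image for x <= 0, where h is 0
because the density is; the derivative at 0 itself is not controlled, whence
the unspecified value c there. *)
Lemma gig_stein_solution (g : R -> R) : continuous g ->
  (forall x, 0 <= g x <= 1) ->
  exists h : R -> R, [/\ gig_test_function p a b h,
    forall x, 0 < x ->
      gig_stein p a b h x = g x - \int[mu]_x (g x * f x) &
    exists c, forall x, x <= 0 -> gig_stein p a b h x = if x == 0 then c else 0].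
Proof.
move=> cg g01; set m := \int[mu]_x (g x * f x).
have intf := integrable_gig_pdf p a0 b0.
have f0 := gig_pdf_ge0 p a0 b0.
have intgf := integrable_mul_density intf f0 cg g01.
pose u x := g x * f x - m * f x.
have intmf : mu.-integrable setT (EFin \o (fun x => m * f x)).
  exact: (integrableZl measurableT m intf).
have intu : mu.-integrable setT (EFin \o u).
  have := integrableB measurableT intgf intmf; exact: eq_integrable.
have Iu : \int[mu]_x u x = 0.
  rewrite RintegralB// RintegralZl// -/m.
  by rewrite [X in m * X]/Rintegral integral_gig_pdf//= mulr1 subrr.
have u0 x : x < 0 -> u x = 0.
  by move=> x0; rewrite /u /f gig_pdf_le0E ?ltW// !mulr0 subrr.
pose H x := \int[mu]_(t in `[0, x]) u t.
have cu (x : R) : 0 < x -> {for x, continuous u}.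
  move=> x0; have [df _] := is_derive_gig_pdf p a0 b0 x0.
  have cf : {for x, continuous f} by exact/differentiable_continuous/derivable1_diffP.
  by apply: cvgB; apply: cvgM => //; [exact: cg|exact: cvg_cst].
have dH (x : R) : 0 < x -> is_derive x 1 H (u x).
  move=> x0.
  have int1 : mu.-integrable `[0, x + 1] (EFin \o u) by exact: integrableS intu.
  have x1 : x < x + 1 by rewrite ltrDl.
  have [dH HE] := continuous_FTC1_closed x1 int1 x0 (cu x x0).
  by apply: DeriveDef => //; rewrite -derive1E.
have fH x : 0 < x -> f x * (H x / f x) = H x.
  by move=> x0; rewrite mulrCA divff ?mulr1// gt_eqF// gig_pdf_gt0.
exists (fun x => H x / f x); split.
- split.
  + move=> x x0; have [? _] := dH x x0.
    have [? _] := is_derive_gig_pdf p a0 b0 x0.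
    apply: derivableM => //; apply: derivableV => //.
    by rewrite gt_eqF// gig_pdf_gt0.
  + apply: cvg_trans (integral_itv0y_cvg intu u0 Iu); apply: near_eq_cvg.
    by near=> x; rewrite -/(f x) fH//; near: x; exact: nbhs_pinfty_gt.
  + have int1 : mu.-integrable `[0, 1] (EFin \o u) by exact: integrableS intu.
    have := cvg_at_right_filter (parameterized_integral_cvg_left ltr01 int1).
    apply: cvg_trans; apply: near_eq_cvg.
    by near=> x; rewrite -/(f x) fH//; near: x; exact: nbhs_right_gt.
- move=> x x0.
  have fn0 : f x != 0 by rewrite gt_eqF// gig_pdf_gt0.
  have dV := is_deriveV fn0 (is_derive_gig_pdf p a0 b0 x0).
  have [_ dE] := is_deriveM (dH x x0) dV.
  rewrite /gig_stein derive1E [X in X + _]dE /GRing.scale/= /u.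
  have : x != 0 by rewrite gt_eqF.
  move=> xn0; move: fn0; rewrite -/f.
  generalize (f x) (g x) m (H x) => fx gx m' Hx fx0.
  by field; rewrite xn0 fx0.
- exists (gig_stein p a b (fun x => H x / f x) 0) => x x0.
  case: eqVneq => [->//|xn0].
  have {x0 xn0} x0 : x < 0 by rewrite lt_neqAle xn0.
  rewrite /gig_stein {2}/f gig_pdf_le0E ?ltW// invr0 !mulr0 addr0.
  rewrite derive1E (near_eq_derive (g := cst 0)) ?derive_cst//.
  near=> y; rewrite /f gig_pdf_le0E ?invr0 ?mulr0//.
  by apply: ltW; near: y; exact: lt_nbhsl.
Unshelve. all: by end_near. Qed.

End gig_stein.

Theorem theorem3p2 (R : realType) (p a b : R) (a_gt0 : 0 < a) (b_gt0 : 0 < b)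
    (d : measure_display) (T : measurableType d) (P : probability T R)
    (X : {RV P >-> R}) (X_gt0 : {ae P, forall t, 0 < X t}) :
  follows_gig X p a b <->
  (forall h : R -> R, gig_test_function p a b h ->
     P.-integrable setT (EFin \o (gig_stein p a b h \o X)) ->
     ('E_P[gig_stein p a b h \o X] = 0)%E).
Proof.
(* the Lebesgue measure lives on the type of reals generated by half-open
   intervals, so the law of X is transported there *)
have mX : measurable_fun [set: T] (X : T -> measurableTypeR R).
  exact: (measurable_funP X).
pose Y : {RV P >-> measurableTypeR R} :=
  HB.pack (X : T -> measurableTypeR R) (isMeasurableFun.Build _ _ _ _ _ mX).
pose nu : probability (measurableTypeR R) R := distribution P Y.
have lawE : follows_gig X p a b <->
  forall A : set (measurableTypeR R), measurable A -> nu A = gig_prob p a b A.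
  by [].
rewrite lawE.
have f0 := gig_pdf_ge0 p a_gt0 b_gt0.
have intf := integrable_gig_pdf p a_gt0 b_gt0.
have mI : measurable (`]0, +oo[%classic : set (measurableTypeR R)).
  exact: measurable_itv.
split=> [law h test ints|stein].
- set s := gig_stein p a b h in ints *.
  have [dh _ _] := test.
  (* h is unconstrained on ]-oo, 0], so the operator is cut off there to get
     a measurable function; almost surely X does not see the difference *)
  pose s0 : measurableTypeR R -> R := s \_ `]0, +oo[.
  have ms0 : measurable_fun setT s0.
    by apply/(measurable_restrictT _ _).1 => //; exact: measurable_gig_stein.
  have mEs0 : measurable_fun setT (EFin \o s0) by exact/measurable_EFinP.
  have mPs0 : measurable_fun [set: T] (EFin \o s0 \o Y) by exact: measurableT_comp.
  have s0s : ae_eq P setT (EFin \o (s \o X)) (EFin \o s0 \o Y).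
    apply: filterS X_gt0 => t Xt _ /=.
    by rewrite /s0 patchE mem_set//= in_itv/= Xt.
  have ints0 : P.-integrable setT (EFin \o s0 \o Y).
    apply: le_integrable ints => // t _ /=.
    by rewrite /s0 patchE; case: ifP => //; rewrite normr0 lee_fin.
  have intnu : nu.-integrable setT (EFin \o s0).
    exact: (integrable_pushforward mX mEs0 ints0).
  rewrite unlock (ae_eq_integral (EFin \o s0 \o Y))//; last first.
    exact: measurable_int ints.
  rewrite -(integral_distribution (X := Y))//.
  rewrite (integral_density intf law intnu).
  have E x : ((EFin \o s0) x * (gig_pdf p a b x)%:E =
      ((fun y => (s y * gig_pdf p a b y)%:E) \_ `]0%R, +oo[) x)%E.
    by rewrite /= /s0 !patchE; case: ifP => _; rewrite ?mul0e.
  under eq_integral do rewrite E.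
  rewrite -integral_mkcond; apply: integral_gig_stein_eq0 => //.
  apply/integrableP; split.
    apply/measurable_EFinP/measurable_funM; first exact: measurable_gig_stein.
    apply: measurable_funTS; apply/measurable_EFinP; exact: measurable_int intf.
  have intabs := integrable_abse intnu.
  have /integrableP[_ ] := intnu; apply: le_lt_trans.
  rewrite [leRHS](integral_density intf law intabs) integral_mkcond.
  rewrite le_eqVlt; apply/orP; left; apply/eqP; apply: eq_integral => x _.
  rewrite /= /s0 !patchE; case: ifP => _; last by rewrite normr0 mul0e.
  by rewrite normrM EFinM (ger0_norm (f0 x)).
- apply: (density_eq_of_continuous intf f0) => g cg g01.
  have [h [test hpos [c hneg]]] := gig_stein_solution p a_gt0 b_gt0 cg g01.
  set m := \int[_]_x _ in hpos.
  set s := gig_stein p a b h in hpos hneg.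
  have mg : measurable_fun [set: measurableTypeR R] g.
    exact: continuous_measurable_fun.
  have sE : s = (fun x => if 0 < x then g x - m else if x == 0 then c else 0).
    apply/funext => x; case: ltP => x0; [exact: hpos|exact: hneg].
  have ms : measurable_fun [set: measurableTypeR R] s.
    rewrite sE; apply: measurable_fun_ifT.
    - by apply: measurable_fun_ltr => //; exact: measurable_cst.
    - by apply: measurable_funB => //; exact: measurable_cst.
    - apply: measurable_fun_ifT; [|exact: measurable_cst|exact: measurable_cst].
      by apply: measurable_fun_eqr => //; exact: measurable_cst.
  (* bounded functions of X are integrable: this covers s, which is g - m up to
     its values on ]-oo, 0], as well as g *)
  have bounded_int (u : measurableTypeR R -> R) K : measurable_fun setT u ->
      (forall x, `|u x| <= K) -> P.-integrable setT (EFin \o (u \o Y)).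
    move=> mu uK; apply: le_integrable (finite_measure_integrable_cst P K measurableT) => //.
      by apply/measurable_EFinP; exact: measurableT_comp.
    by move=> t _; rewrite lee_fin (le_trans (uK _))// ler_norm.
  have ints : P.-integrable setT (EFin \o (s \o X)).
    apply: (bounded_int s (1 + `|m| + `|c|)) => // x; rewrite sE.
    have /andP[gx0 gx1] := g01 x.
    have := ler_normB (g x) m; rewrite (ger0_norm gx0) => gm.
    have m0 : 0 <= `|m| by []. have c0 : 0 <= `|c| by [].
    by case: ifP => _; [|case: ifP => _; rewrite ?normr0]; lra.
  have intg : P.-integrable setT (EFin \o (g \o Y)).
    apply: (bounded_int g 1) => // x.
    by have /andP[gx0 gx1] := g01 x; rewrite ger0_norm.
  have intm : P.-integrable setT (EFin \o cst m).
    exact: finite_measure_integrable_cst.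
  have Em : (\int[P]_t (EFin \o cst m) t = m%:E)%E.
    by have := expectation_cst P m; rewrite unlock.
  have := stein h test ints; rewrite unlock.
  rewrite (ae_eq_integral (fun t => (EFin \o (g \o Y)) t - (EFin \o cst m) t)%E)//; last 3 first.
  - exact: measurable_int ints.
  - by apply: emeasurable_funB; [exact: measurable_int intg|exact: measurable_int intm].
  - by apply: filterS X_gt0 => t Xt _; rewrite /= -/s hpos.
  have /fineK gK := integrable_fin_num measurableT intg.
  rewrite integralB// Em -gK -EFinB => -[] /subr0_eq Eg.
  rewrite ge0_integral_distribution; last 2 first.
  - exact/measurable_EFinP.
  - by move=> x; rewrite lee_fin; have /andP[] := g01 x.
  rewrite -[LHS]gK Eg /m /Rintegral fineK//.
  apply: integrable_fin_num => //.
  exact: (integrable_mul_density intf f0 cg g01).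
Qed.
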